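(* For every real number $N$ there exist a graph $G$ and a vertex $u \in V(G)$ such that for every positive integer $d$, $$f_d(G,u) - f(G,u) \ge N \quad\text{and}\quad \frac{f_d(G,u)}{f(G,u)} \ge N.$$
   Context: Graphs are simple and undirected and may be infinite. Original firefighter game on a graph $G$ with $k$ firefighters and fire at $u$: on turn $0$, the vertex $u$ starts burning, and then the firefighters protect up to $k$ unburnt vertices. On each subsequent turn, first the fire spreads to every unburnt, unprotected neighbour of every burning vertex; then the firefighters protect up to $k$ further unburnt vertices, chosen without any restriction. Once a vertex is burning or protected it remains so for the rest of the game. The fire is contained if after finitely many turns a point is reached where the fire can no longer spread (no burning vertex has an unburnt, unprotected neighbour). $f(G,u)$ is the minimum $k$ for which a fire breaking out at $u$ can be contained in this game. Distance-$d$ (distance-restricted) firefighter game with $k$ firefighters: the same, except that on turn $0$ the $k$ firefighters are placed on unburnt vertices (several may occupy the same vertex), protecting the vertices they occupy, and on each subsequent turn, after the fire spreads, each firefighter moves from its current vertex to an unburnt vertex at distance at most $d$ (possibly staying put, and several may occupy the same vertex), where the distance is measured in the subgraph of $G$ induced by the currently unburnt vertices (firefighters may not move through the fire), and protects the vertex it arrives at. $f_d(G,u)$ is the minimum $k$ for which a fire breaking out at $u$ can be contained in this game. *)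

(* Defs.v *)
From HB Require Import structures.
From mathcomp Require Import all_boot all_order all_algebra.
From mathcomp Require Import all_classical all_reals.

Set Implicit Arguments.
Unset Strict Implicit.
Unset Printing Implicit Defensive.

Local Open Scope classical_set_scope.
Local Open Scope card_scope.

Record sgraph := SGraph {
  vertex :> Type;
  edge : vertex -> vertex -> Prop;
  edge_sym : forall x y, edge x y -> edge y x;
  edge_irrefl : forall x, ~ edge x x }.

Section Distance.
Variable G : sgraph.

Definition induced_edge (U : set G) (x y : G) : Prop :=
  [/\ U x, U y & edge x y].

Fixpoint walk (e : G -> G -> Prop) (n : nat) (x y : G) : Prop :=
  if n is n'.+1 then exists2 z, e x z & walk e n' z y else x = y.

(* For x and y in U: their distance in the induced subgraph G[U] is finite
   and at most d. *)
Definition dist_le (U : set G) (d : nat) (x y : G) : Prop :=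
  exists2 n, (n <= d)%N & walk (induced_edge U) n x y.

End Distance.

Section Game.
Variables (G : sgraph) (u : G).

Definition spread (B Q : set G) : set G :=
  [set y | [/\ ~ B y, ~ Q y & exists2 x, B x & edge x y]].

(* The fire is deterministic, so a play is determined by the sets P t of
   vertices protected on turn t. The state is the pair (burning vertices,
   protected vertices) at the end of turn t. *)
Fixpoint play (P : nat -> set G) (t : nat) : set G * set G :=
  if t is t'.+1 then
    let: (B, Q) := play P t' in (B `|` spread B Q, Q `|` P t)
  else ([set u], P 0%N).

(* Protecting happens after the fire spreads, so [burning P t] is also the
   burning set at the moment when the moves of turn t are made. *)
Definition burning (P : nat -> set G) (t : nat) : set G := (play P t).1.
Definition protected (P : nat -> set G) (t : nat) : set G := (play P t).2.

Definition contained (P : nat -> set G) : Prop :=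
  exists t, spread (burning P t) (protected P t) = set0.

Definition legal (k : nat) (P : nat -> set G) : Prop :=
  forall t, P t #<= `I_k /\ P t `<=` ~` burning P t.

Definition can_contain (k : nat) : Prop :=
  exists2 P, legal k P & contained P.

(* [pos t i] is the vertex occupied by firefighter i at the end of turn t. *)
Definition occupied (k : nat) (pos : nat -> 'I_k -> G) (t : nat) : set G :=
  range (pos t).

Definition legal_dist (d k : nat) (pos : nat -> 'I_k -> G) : Prop :=
  (forall t i, ~ burning (occupied pos) t (pos t i)) /\
  (forall t i,
     dist_le (~` burning (occupied pos) t.+1) d (pos t i) (pos t.+1 i)).

Definition can_contain_dist (d k : nat) : Prop :=
  exists2 pos : nat -> 'I_k -> G,
    legal_dist d pos & contained (occupied pos).

Definition is_least (A : nat -> Prop) (m : nat) : Prop :=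
  A m /\ forall k, A k -> (m <= k)%N.

(* f(G,u) = m, resp. f_d(G,u) = m; both minima may fail to exist when G is
   infinite, hence relations rather than functions. *)
Definition firefighter_number (m : nat) : Prop := is_least can_contain m.
Definition dist_firefighter_number (d m : nat) : Prop :=
  is_least (can_contain_dist d) m.

End Game.

(* Main.v *)
Require Import Defs.
From mathcomp Require Import all_boot all_order all_algebra.
From mathcomp Require Import all_classical all_reals.
Import Order.TTheory GRing.Theory Num.Theory.
Local Open Scope ring_scope.

Set Implicit Arguments.
Unset Strict Implicit.
Unset Printing Implicit Defensive.

(** Let the fire break out at the centre of a spider with [n + 1] infinite legs.
    One unrestricted firefighter suffices: on turn [t] it blocks leg [t] just
    ahead of the fire. A distance-restricted firefighter can never cross the
    centre, hence never changes leg, so whatever [d] is, every leg needs its own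
    firefighter. *)

Section Play.
Local Open Scope classical_set_scope.
Variables (G : sgraph) (u : G).
Implicit Types P : nat -> set G.

Lemma burningS P t :
  burning u P t.+1 = burning u P t `|` spread (burning u P t) (protected u P t).
Proof. by rewrite /burning /protected /=; case: (play u P t). Qed.

Lemma protectedS P t : protected u P t.+1 = protected u P t `|` P t.+1.
Proof. by rewrite /protected /=; case: (play u P t). Qed.

Lemma protectedE P t y :
  protected u P t y <-> exists2 s, (s <= t)%N & P s y.
Proof.
elim: t => [|t IH]; first by split=> [Py|[[|s]]//]; exists 0%N.
rewrite protectedS; split=> [[/IH[s le_st Ps]|Pt]|[s]].
- by exists s => //; apply: leqW.
- by exists t.+1.
- rewrite leq_eqVlt => /orP[/eqP->|lt_st] Ps; first by right.
  by left; apply/IH; exists s.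
Qed.

Lemma protected_mono P s t y :
  (s <= t)%N -> protected u P s y -> protected u P t y.
Proof.
move=> le_st /protectedE[r le_rs Pr]; apply/protectedE.
by exists r => //; apply: leq_trans le_st.
Qed.

Lemma burning_origin P t : burning u P t u.
Proof. by elim: t => [|t IH] //; rewrite burningS; left. Qed.

End Play.

Section Spider.
Local Open Scope classical_set_scope.
Variable m : nat.

(* [None] is the centre; [Some (i, j)] lies on leg [i] at distance [j + 1] from
   the centre. *)
Definition spider_vertex : Type := option ('I_m * nat).

Definition spider_edge (x y : spider_vertex) : Prop :=
  match x, y with
  | None, None => False
  | None, Some (_, j) | Some (_, j), None => j = 0%N
  | Some (i, j), Some (i', j') => i = i' /\ (j' = j.+1 \/ j = j'.+1)
  end.

Lemma spider_edge_sym x y : spider_edge x y -> spider_edge y x.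
Proof. by case: x y => [[i j]|] [[i' j']|] //= [-> []]; auto. Qed.

Lemma spider_edge_irrefl x : ~ spider_edge x x.
Proof. by case: x => [[i j]|] //= [_ []] /eqP; rewrite ltn_eqF // gtn_eqF. Qed.

Definition spider : sgraph := SGraph spider_edge_sym spider_edge_irrefl.

Definition center : spider := None.
Definition on_leg (i : 'I_m) (j : nat) : spider := Some (i, j).

Implicit Types P : nat -> set spider.

(* [on_leg i j] burns on turn [j + 1] or never. *)
Lemma burning_leg P t i j :
  burning center P t (on_leg i j) <->
  (j < t)%N /\
    forall j', (j' <= j)%N -> ~ protected center P j' (on_leg i j').
Proof.
elim: t i j => [|t IH] i j; first by split=> [|[]].
rewrite burningS; split=> [[/IH[lt_jt free]|]|[]].
- by split=> //; apply: leqW.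
- move=> [unburnt unprot [[[i' k]|] burnt /=]]; last first.
    move=> eq_j0; rewrite eq_j0 in unprot *; split=> // -[|//] _.
    by move/(protected_mono (leq0n t)).
  move=> [eq_i jk]; move: burnt; rewrite {}eq_i => /IH[lt_kt free].
  (* Fire cannot arrive from the outer neighbour: if [j.+1] burns by turn [t], the induction
     hypothesis already makes [j] burn by then. *)
  case: jk => eq_jk; last first.
    case: unburnt; apply/IH; rewrite eq_jk in lt_kt free; split=> [|j' le_j'j].
      exact: ltnW.
    exact/free/leqW.
  rewrite eq_jk in unprot *; split=> // j'.
  rewrite leq_eqVlt => /orP[/eqP->|/free//].
  by move/(protected_mono lt_kt).
(* Only the front [j = t] is new; it is lit by the previous vertex of the leg, or by the centre when
   [t = 0]. *)
- rewrite ltnS leq_eqVlt => /orP[/eqP-> {j}|lt_jt] free; last by left; apply/IH.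
  right; split; [by move/IH; rewrite ltnn => -[]|exact: free|].
  case: t IH free => [|t] IH free; first by exists center.
  exists (on_leg i t); last by split; [|left].
  by apply/IH; split=> // j' le_j't; apply/free/leqW.
Qed.

(** Whatever [t] is, [on_leg i t] catches fire exactly on turn [t + 1], so the spread after turn [t]
    is never empty. *)
Lemma not_contained_free_leg P i :
  (forall t j, ~ P t (on_leg i j)) -> ~ contained center P.
Proof.
move=> freeP [t eq0].
have burns s : (t < s)%N -> burning center P s (on_leg i t).
  by move=> lt_ts; apply/burning_leg; split=> // j _ /protectedE[r _ /freeP].
have := burns t.+1 (leqnn _); rewrite burningS eq0 setU0.
by move/burning_leg; rewrite ltnn => -[].
Qed.

(** A vertex burning on turn [t + 1] lies strictly between the centre and a block at index at most
    [t], so it was already burning on turn [t]. *)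
Lemma contained_legs P t :
    (forall i, exists2 j, (j <= t)%N & protected center P j (on_leg i j)) ->
  contained center P.
Proof.
move=> blocked; exists t; rewrite -subset0 => y y_spread.
have: burning center P t.+1 y by rewrite burningS; right.
case: y y_spread => [[i j]|] [unburnt _ _]; last first.
  by case: unburnt; apply: burning_origin.
case/burning_leg=> lt_jt free; have [j' le_j't prot] := blocked i.
case: (leqP j' j) => [/free//|lt_j'j].
apply: unburnt; apply/burning_leg; split=> //.
exact: leq_trans le_j't.
Qed.

(** The centre is the only junction between legs. The length [l] is arbitrary, which makes the later
    bound independent of [d]. *)
Lemma walk_avoids_center (U : set spider) l i j y :
    ~ U center -> walk (induced_edge U) l (on_leg i j) y ->
  exists j', y = on_leg i j'.
Proof.
move=> Uc; elim: l j => [|l IH] j /=; first by move=> <-; exists j.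
case=> -[[i' k]|] [_ Uz]; last by move: Uz.
by move=> /= [<- _]; apply: IH.
Qed.

Lemma legal_dist_leg d k (pos : nat -> 'I_k -> spider) a :
    legal_dist center d pos ->
  exists i, forall t, exists j, pos t a = on_leg i j.
Proof.
move=> [unburnt moves]; case pos0: (pos 0%N a) (unburnt 0%N a) => [[i j]|];
  last by case; apply: burning_origin.
move=> _; exists i; elim=> [|t [j' posE]]; first by exists j.
have [l _] := moves t a; rewrite posE; apply: walk_avoids_center.
by apply; apply: burning_origin.
Qed.

Lemma spider_dist_firefighter_number d :
  dist_firefighter_number center d m.
Proof.
split=> [|k [pos legal_pos contained_pos]].
  (* One firefighter per leg stands still next to the centre; walks of length [0] are legal for
     every [d]. *)
  pose pos (t : nat) (i : 'I_m) := on_leg i 0.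
  have prot i : protected center (occupied pos) 0 (on_leg i 0) by exists i.
  have unburnt t i : ~ burning center (occupied pos) t (on_leg i 0).
    by move=> /burning_leg[_ /(_ 0%N (leqnn _))]; apply.
  exists pos; last by apply: (@contained_legs _ 0) => i; exists 0%N.
  by split=> t i; [exact: unburnt|exists 0%N].
have [leg posE] := choice (fun a => legal_dist_leg a legal_pos).
(* If every leg is occupied, a section of [leg] is injective and gives [m <= k]; otherwise some leg
   is never protected and the fire escapes along it. *)
have [occ|] := pselect (forall i, exists a, leg a = i).
  have [g legK] := choice occ.
  by have := leq_card _ (can_inj legK); rewrite !card_ord.
move/existsNP=> [i /forallNP not_leg]; exfalso.
apply: (@not_contained_free_leg _ i) contained_pos => t j [a _].
have [j' ->] := posE a t; case=> leg_a _; exact: not_leg leg_a.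
Qed.

End Spider.

Section SpiderFirefighter.
Local Open Scope classical_set_scope.

Lemma spider_firefighter_number n : firefighter_number (center n.+1) 1.
Proof.
split=> [|[|//] [P legalP contP]]; last first.
  (* Zero firefighters leave the leg [ord0] free; it exists because there are [n.+1] legs. *)
  exfalso; apply: (@not_contained_free_leg _ _ ord0) contP => t j.
  by have [] := legalP t; rewrite II0 card_le0 => /eqP-> _ [].
(* For [t > n], [inord t] is a junk leg, but [on_leg _ t] cannot burn by
   turn [t], so the move is still legal. *)
exists (fun t => [set on_leg (inord t : 'I_n.+1) t]).
  move=> t; split; last by move=> _ -> /burning_leg[]; rewrite ltnn.
  by have := @card_set1 _ (on_leg (inord t : 'I_n.+1) t);
    rewrite card_eq_le => /andP[].
apply: (@contained_legs _ _ n) => i; exists i; first by rewrite -ltnS.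
by apply/protectedE; exists i => //=; rewrite inord_val.
Qed.

End SpiderFirefighter.

Theorem theorem2p2 (R : realType) (N : R) :
  exists (G : sgraph) (u : G) (f : nat),
    [/\ firefighter_number u f,
        (0 < f)%N
      & forall d : nat, (0 < d)%N ->
        exists fd : nat,
          [/\ dist_firefighter_number u d fd,
              N <= fd%:R - f%:R
            & N <= fd%:R / f%:R]].
Proof.
have [n leNn] : exists n : nat, N <= n%:R.
  exists (Num.bound `|N|); apply: le_trans (ler_norm N) (ltW _).
  exact/archi_boundP/normr_ge0.
(* With [n.+1] legs the difference is exactly [n] and the ratio [n + 1]. *)
exists (spider n.+1), (center n.+1), 1%N; split=> //.
  exact: spider_firefighter_number.
move=> d _; exists n.+1; split; first exact: spider_dist_firefighter_number.
  by rewrite -natr1 addrK.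
by rewrite divr1 -natr1; apply: le_trans leNn _; rewrite lerDl.
Qed.
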